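(* Let $b$ be a geometric structure on a manifold $M$. The mapping $\{\cdot,\cdot\}_b:\mathcal{C}^{\infty}(M,\mathbb{R})\times\mathcal{C}^{\infty}(M,\mathbb{R})\rightarrow \mathcal{C}^{\infty}(M,\mathbb{R})$ given by $$\{F,G\}_b:=b(\nabla_{b}^{L}F,\nabla_{b}^{L}G)=b(\nabla_{b}^{R}F,\nabla_{b}^{R}G),\quad \forall F,G\in\mathcal{C}^{\infty}(M,\mathbb{R}),$$ is a Leibniz bracket, and consequently $(M,\{\cdot,\cdot\}_b)$ is a Leibniz manifold.
   Context: All manifolds are connected, Hausdorff, paracompact and smooth; all maps are smooth. A geometric structure on a manifold $M$ is a non-degenerate $(0,2)$-tensor field $b:\mathfrak{X}(M)\times\mathfrak{X}(M)\to\mathcal{C}^{\infty}(M,\mathbb{R})$ (no symmetry is assumed). For $F\in\mathcal{C}^{\infty}(M,\mathbb{R})$, the left-gradient $\nabla^{L}_{b}F$ and the right-gradient $\nabla^{R}_{b}F$ are the vector fields uniquely defined by $b(\nabla^{L}_{b}F,X)=\mathrm{d}F\cdot X$ and $b(X,\nabla^{R}_{b}F)=\mathrm{d}F\cdot X$ for all $X\in\mathfrak{X}(M)$. A Leibniz bracket on $\mathcal{C}^{\infty}(M,\mathbb{R})$ is an $\mathbb{R}$-bilinear mapping $\mathcal{C}^{\infty}(M,\mathbb{R})\times\mathcal{C}^{\infty}(M,\mathbb{R})\to\mathcal{C}^{\infty}(M,\mathbb{R})$ which is a derivation in each entry; a Leibniz manifold is a manifold together with a Leibniz bracket on its algebra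 of smooth functions. *)

(* Defs.v *)
From HB Require Import structures.
From mathcomp Require Import all_boot all_order all_algebra.
From mathcomp Require Import all_classical all_reals all_analysis.

Set Implicit Arguments.
Unset Strict Implicit.
Unset Printing Implicit Defensive.

Import Order.TTheory GRing.Theory Num.Theory.
Import numFieldNormedType.Exports.
Local Open Scope classical_set_scope.
Local Open Scope ring_scope.

Section SmoothOn.
Variables (R : realType) (n : nat).
Implicit Types (U : set 'rV[R]_n) (f g : 'rV[R]_n -> R).

Fixpoint Ck_on (k : nat) U f : Prop :=
  if k is k'.+1 then
    (forall x, U x -> differentiable f x) /\ (forall v, Ck_on k' U ('D_v f))
  else forall x, U x -> {for x, continuous f}.

Definition smooth_on U f : Prop := forall k, Ck_on k U f.

Lemma near_eq_differentiable f g x :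
  {near nbhs x, f =1 g} -> differentiable f x -> differentiable g x.
Proof.
move=> fg df.
have gfx : g x = f x by rewrite (nbhs_singleton fg).
have [dfc dfE] := (diff_locallyP x f).1 df.
have e : g \o shift x = cst (g x) + 'd f x +o_ 0 id.
  apply/eqaddoP => e e0; move/eqaddoP : dfE => /(_ e e0) H.
  have H2 : \forall h \near (0 : 'rV[R]_n), f (h + x) = g (h + x).
    have H1 : (fun h : 'rV[R]_n => h + x) @ (0 : 'rV[R]_n) --> x.
      have /(_ (0 : 'rV[R]_n)) : continuous (fun h : 'rV[R]_n => h + x).
        by move=> h; apply: continuousD => //; exact: cst_continuous.
      by rewrite /continuous_at add0r.
    exact: (H1 _ fg).
  near=> h.
  have hfg : f (h + x) = g (h + x) by near: h.
  have hH : `|(f \o shift x - (cst (f x) + 'd f x)) h| <= e * `|id h|.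
    by near: h.
  rewrite (_ : (_ - _) h = (f \o shift x - (cst (f x) + 'd f x)) h) //.
  by rewrite !fctE /= -hfg gfx.
apply/diff_locallyP; have -> : 'd g x = 'd f x :> (_ -> _) by exact: diff_unique.
by split.
Unshelve. all: by end_near. Qed.

Lemma eq_Ck_on k U f g : open U -> (forall x, U x -> f x = g x) ->
  Ck_on k U f -> Ck_on k U g.
Proof.
move=> oU; elim: k f g => [|k IH] f g fg.
  move=> cf x Ux; have := cf x Ux.
  rewrite /prop_for /continuous_at -(fg x Ux); apply: cvg_trans.
  apply: (@near_eq_cvg _ _ (nbhs x)).
  exact: filterS fg (open_nbhs_nbhs (conj oU Ux)).
move=> [df cf]; split => [x Ux|v].
  apply: near_eq_differentiable (df x Ux).
  exact: filterS fg (open_nbhs_nbhs (conj oU Ux)).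
apply: IH (cf v) => x Ux; apply: near_eq_derive.
exact: filterS fg (open_nbhs_nbhs (conj oU Ux)).
Qed.

Lemma Ck_onW k U f : Ck_on k.+1 U f -> Ck_on k U f.
Proof.
elim: k f => [|k IH] f [df cf]; last by split=> // v; exact: IH.
by move=> x Ux; exact: differentiable_continuous (df x Ux).
Qed.

Lemma Ck_on_cst k U (c : R) : Ck_on k U (cst c).
Proof.
elim: k c => [|k IH] c /=; first by move=> x _; exact: cst_continuous.
split=> [x _|v]; first exact: differentiable_cst.
rewrite (_ : 'D_v (cst c) = cst 0); first exact: IH.
by apply/funext => x; rewrite derive_cst.
Qed.

Lemma Ck_onD k U f g : open U -> Ck_on k U f -> Ck_on k U g ->
  Ck_on k U (f + g).
Proof.
move=> oU; elim: k f g => [|k IH] f g.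
  by move=> cf cg x Ux; apply: continuousD; [exact: cf|exact: cg].
move=> [df cf] [dg cg]; split=> [x Ux|v].
  by apply: differentiableD; [exact: df|exact: dg].
apply: eq_Ck_on oU _ (IH _ _ (cf v) (cg v)) => x Ux.
by rewrite deriveD//; apply: diff_derivable; [exact: df|exact: dg].
Qed.

Lemma Ck_onM k U f g : open U -> Ck_on k U f -> Ck_on k U g ->
  Ck_on k U (f * g).
Proof.
move=> oU; elim: k f g => [|k IH] f g.
  by move=> cf cg x Ux; apply: continuousM; [exact: cf|exact: cg].
move=> Cf Cg; have [df cf] := Cf; have [dg cg] := Cg; split=> [x Ux|v].
  by apply: differentiableM; [exact: df|exact: dg].
apply: (@eq_Ck_on _ _ (f * 'D_v g + g * 'D_v f)) => // [x Ux|].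
  by rewrite deriveM//; apply: diff_derivable; [exact: df|exact: dg].
apply: Ck_onD => //; apply: IH; [exact: Ck_onW|exact: cg|exact: Ck_onW|exact: cf].
Qed.

Lemma smooth_on_cst U (c : R) : smooth_on U (cst c).
Proof. by move=> k; exact: Ck_on_cst. Qed.

Lemma smooth_onD U f g : open U ->
  smooth_on U f -> smooth_on U g -> smooth_on U (f + g).
Proof. by move=> oU sf sg k; apply: Ck_onD. Qed.

Lemma smooth_onM U f g : open U ->
  smooth_on U f -> smooth_on U g -> smooth_on U (f * g).
Proof. by move=> oU sf sg k; apply: Ck_onM. Qed.

Lemma smooth_onN U f : open U -> smooth_on U f -> smooth_on U (- f).
Proof.
move=> oU sf; have -> : - f = cst (-1) * f.
  by apply/funext => x; rewrite !fctE mulN1r.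
by apply: smooth_onM => //; exact: smooth_on_cst.
Qed.

End SmoothOn.

Definition paracompact (T : topologicalType) : Prop :=
  forall C : set (set T), (forall A, C A -> open A) ->
    \bigcup_(A in C) A = [set: T] ->
  exists D : set (set T),
    [/\ forall B, D B -> open B,
        \bigcup_(B in D) B = [set: T],
        forall B, D B -> exists2 A, C A & B `<=` A &
        forall x : T, exists2 N, nbhs x N &
          finite_set [set B | D B /\ B `&` N !=set0]].

(* [chart_inv] is only meaningful on [chart_img], and [chart_map] on
   [chart_dom]; both are total functions with arbitrary values elsewhere. *)
Record chart (R : realType) (n : nat) (T : topologicalType) := Chart {
  chart_dom : set T;
  chart_img : set 'rV[R]_n;
  chart_map : T -> 'rV[R]_n;
  chart_inv : 'rV[R]_n -> T;
  chart_dom_open : open chart_dom;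
  chart_img_open : open chart_img;
  chart_mapP : forall p, chart_dom p -> chart_img (chart_map p);
  chart_invP : forall z, chart_img z -> chart_dom (chart_inv z);
  chart_mapK : forall p, chart_dom p -> chart_inv (chart_map p) = p;
  chart_invK : forall z, chart_img z -> chart_map (chart_inv z) = z;
  chart_map_cont : forall p, chart_dom p -> {for p, continuous chart_map};
  chart_inv_cont : forall z, chart_img z -> {for z, continuous chart_inv} }.

(* The smooth structure is given by an indexed, not necessarily maximal,
   smooth atlas. *)
Record manifold (R : realType) (n : nat) := Manifold {
  points :> topologicalType;
  manifold_hausdorff : hausdorff_space points;
  manifold_connected : connected [set: points];
  manifold_paracompact : paracompact points;
  atlas : Type;
  chart_of : atlas -> chart R n points;
  atlas_cover : forall p, exists i, chart_dom (chart_of i) p;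
  atlas_smooth : forall i j k,
    smooth_on (chart_img (chart_of i) `&`
               chart_inv (chart_of i) @^-1` chart_dom (chart_of j))
      (fun z => chart_map (chart_of j) (chart_inv (chart_of i) z) 0 k) }.

Section ManifoldDefs.
Variables (R : realType) (n : nat) (M : manifold R n).
Implicit Types (p : M) (i j : atlas M).

Definition mdom i : set M := chart_dom (chart_of i).
Definition mimg i : set 'rV[R]_n := chart_img (chart_of i).
Definition mmap i : M -> 'rV[R]_n := chart_map (chart_of i).
Definition minv i : 'rV[R]_n -> M := chart_inv (chart_of i).

Definition chart_at p : atlas M := projT1 (cid (atlas_cover p)).

Lemma chart_atP p : mdom (chart_at p) p.
Proof. exact: projT2 (cid (atlas_cover p)). Qed.

Lemma mimg_open i : open (mimg i). Proof. exact: chart_img_open. Qed.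
Arguments mimg_open i : clear implicits.

Definition smooth_fun (f : M -> R) : Prop :=
  forall i, smooth_on (mimg i) (f \o minv i).

Definition Cinf_pred : {pred M -> R} := mem [set f | smooth_fun f].

Record Cinf := MkCinf { Cinf_val :> M -> R; _ : Cinf_val \in Cinf_pred }.
HB.instance Definition _ := [isSub for Cinf_val].
HB.instance Definition _ := [Choice of Cinf by <:].

Lemma Cinf_smooth (f : Cinf) : smooth_fun f.
Proof. by case: f => f /= /set_mem. Qed.

Lemma Cinf_subring_closed : subring_closed Cinf_pred.
Proof.
split=> [|f g|f g].
- by apply/mem_set => i; exact: smooth_on_cst.
- move=> /set_mem sf /set_mem sg; apply/mem_set => i.
  exact: (smooth_onD (mimg_open i) (sf i) (smooth_onN (mimg_open i) (sg i))).
- move=> /set_mem sf /set_mem sg; apply/mem_set => i.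
  exact: smooth_onM (mimg_open i) (sf i) (sg i).
Qed.

HB.instance Definition _ :=
  GRing.SubChoice_isSubComPzRing.Build _ _ Cinf Cinf_subring_closed.

Lemma Cinf_scale_subproof (a : R) (f : Cinf) :
  (fun p => a * f p) \in Cinf_pred.
Proof.
apply/mem_set => i.
exact: smooth_onM (mimg_open i) (@smooth_on_cst R n _ a) (Cinf_smooth f i).
Qed.

Definition Cinf_scale (a : R) (f : Cinf) : Cinf :=
  MkCinf (Cinf_scale_subproof a f).

Lemma CinfP (f g : Cinf) : (forall p, f p = g p) -> f = g.
Proof. by move=> fg; apply/val_inj/funext. Qed.

Program Definition Cinf_lmodMixin :=
  @GRing.Zmodule_isLmodule.Build R Cinf Cinf_scale _ _ _ _.
Next Obligation. by move=> a b f; apply/CinfP => p /=; rewrite mulrA. Qed.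
Next Obligation. by move=> f; apply/CinfP => p /=; rewrite mul1r. Qed.
Next Obligation. by move=> a f g; apply/CinfP => p /=; rewrite [LHS]mulrDr. Qed.
Next Obligation. by move=> f a b; apply/CinfP => p /=; rewrite [LHS]mulrDl. Qed.
HB.instance Definition _ := Cinf_lmodMixin.

(* A tangent vector at p is the family of its coordinate vectors in the charts
   around p, subject to the usual transformation law
   v_j^k = d(x_j^k)(v_i); it is normalized to 0 in the charts not containing p,
   so that equality of tangent vectors is equality of families. *)
Definition is_tangent p (v : atlas M -> 'rV[R]_n) : Prop :=
  (forall i, ~ mdom i p -> v i = 0) /\
  (forall i j, mdom i p -> mdom j p -> forall k,
     v j 0 k = 'd (fun z => mmap j (minv i z) 0 k) (mmap i p) (v i)).

Definition is_vector_field (X : M -> atlas M -> 'rV[R]_n) : Prop :=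
  (forall p, is_tangent p (X p)) /\
  (forall i k, smooth_on (mimg i) (fun z => X (minv i z) i 0 k)).

Definition vector_field_pred : {pred M -> atlas M -> 'rV[R]_n} :=
  mem [set X | is_vector_field X].

Record vector_field := VectorField {
  vector_field_val :> M -> atlas M -> 'rV[R]_n;
  _ : vector_field_val \in vector_field_pred }.
HB.instance Definition _ := [isSub for vector_field_val].
HB.instance Definition _ := [Choice of vector_field by <:].

Lemma vector_fieldP (X : vector_field) : is_vector_field X.
Proof. by case: X => X /= /set_mem. Qed.

Lemma vector_field_zmod_closed : zmod_closed vector_field_pred.
Proof.
split=> [|X Y].
  apply/mem_set; split=> [p|i k].
    split=> // i j _ _ k; rewrite [RHS]linear0 /=.
    by rewrite [LHS]mxE.
  rewrite (_ : (fun _ => _) = cst 0); first exact: smooth_on_cst.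
  by apply/funext => z; rewrite [LHS]mxE.
move=> /set_mem [tX sX] /set_mem [tY sY]; apply/mem_set; split=> [p|i k].
  have [zX cX] := tX p; have [zY cY] := tY p; split=> [i ip|i j ip jp k].
    by rewrite !fctE zX// zY// subrr.
  by rewrite !fctE !mxE linearB /= (cX i j)// (cY i j).
rewrite (_ : (fun _ => _) =
    (fun z => X (minv i z) i 0 k) + - (fun z => Y (minv i z) i 0 k)).
  exact: (smooth_onD (mimg_open i) (sX i k)
            (smooth_onN (mimg_open i) (sY i k))).
by apply/funext => z; rewrite !fctE !mxE.
Qed.

HB.instance Definition _ :=
  GRing.SubChoice_isSubZmodule.Build _ _ vector_field vector_field_zmod_closed.

Lemma vector_field_scale_subproof (f : Cinf) (X : vector_field) :
  (fun p i => f p *: X p i) \in vector_field_pred.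
Proof.
have [tX sX] := vector_fieldP X; apply/mem_set; split=> [p|i k].
  have [zX cX] := tX p; split=> [i ip|i j ip jp k]; first by rewrite zX// scaler0.
  by rewrite !mxE linearZ /= (cX i j).
rewrite (_ : (fun _ => _) = (f \o minv i) * (fun z => X (minv i z) i 0 k)).
  exact: smooth_onM (mimg_open i) (Cinf_smooth f i) (sX i k).
by apply/funext => z; rewrite !fctE !mxE.
Qed.

Definition vector_field_scale (f : Cinf) (X : vector_field) : vector_field :=
  VectorField (vector_field_scale_subproof f X).

Lemma eq_vector_field (X Y : vector_field) :
  (forall p i, X p i = Y p i) -> X = Y.
Proof. by move=> XY; apply/val_inj/funext => p; apply/funext => i; apply: XY. Qed.

Program Definition vector_field_lmodMixin :=
  @GRing.Zmodule_isLmodule.Build Cinf vector_field vector_field_scale _ _ _ _.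
Next Obligation.
by move=> f g X; apply/eq_vector_field => p i /=; rewrite scalerA.
Qed.
Next Obligation.
by move=> X; apply/eq_vector_field => p i /=; rewrite [LHS]scale1r.
Qed.
Next Obligation.
by move=> f X Y; apply/eq_vector_field => p i /=; rewrite [LHS]scalerDr.
Qed.
Next Obligation.
by move=> X f g; apply/eq_vector_field => p i /=; rewrite [LHS]scalerDl.
Qed.
HB.instance Definition _ := vector_field_lmodMixin.

(* dF . X, computed in one chart around each point; by the transformation law
   in [is_tangent] the value does not depend on that chart. *)
Definition dfun (F : Cinf) (X : vector_field) : M -> R := fun p =>
  let i := chart_at p in 'd (F \o minv i) (mmap i p) (X p i).

(* A (0,2)-tensor field, as a C^oo(M)-bilinear map on vector fields, that is
   non-degenerate at every point: b(X, Y)(p) only depends on X(p) and Y(p), and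
   every tangent vector at p is the value of some vector field. *)
Record geometric_structure := GeometricStructure {
  gs_form :> vector_field -> vector_field -> Cinf;
  gs_linearl : forall Y, scalar (gs_form ^~ Y);
  gs_linearr : forall X, scalar (gs_form X);
  gs_nondegl : forall p X, (forall Y, gs_form X Y p = 0) -> X p = 0;
  gs_nondegr : forall p Y, (forall X, gs_form X Y p = 0) -> Y p = 0 }.

Definition is_left_gradient (b : geometric_structure) (F : Cinf)
    (X : vector_field) : Prop :=
  forall Y, b X Y = dfun F Y :> (M -> R).

Definition is_right_gradient (b : geometric_structure) (F : Cinf)
    (X : vector_field) : Prop :=
  forall Y, b Y X = dfun F Y :> (M -> R).

Lemma left_gradient_unique b F X X' :
  is_left_gradient b F X -> is_left_gradient b F X' -> X = X'.
Proof.
move=> gX gX'; apply/eqP; rewrite -subr_eq0; apply/eqP/eq_vector_field => p i.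
suff -> : (X - X') p = 0 by [].
apply: (@gs_nondegl b) => Y.
have -> : b (X - X') Y = b X Y - b X' Y.
  have := gs_linearl b Y (-1) X' X.
  by rewrite scaleN1r mulN1r (addrC _ X) [RHS]addrC.
have E : b X Y = b X' Y by apply/val_inj; rewrite /= gX gX'.
by rewrite E subrr.
Qed.

Lemma right_gradient_unique b F X X' :
  is_right_gradient b F X -> is_right_gradient b F X' -> X = X'.
Proof.
move=> gX gX'; apply/eqP; rewrite -subr_eq0; apply/eqP/eq_vector_field => p i.
suff -> : (X - X') p = 0 by [].
apply: (@gs_nondegr b) => Y.
have -> : b Y (X - X') = b Y X - b Y X'.
  have := gs_linearr b Y (-1) X' X.
  by rewrite scaleN1r mulN1r (addrC _ X) [RHS]addrC.
have E : b Y X = b Y X' by apply/val_inj; rewrite /= gX gX'.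
by rewrite E subrr.
Qed.

(* The vector field with the defining property; the default value 0 of [xget]
   is never used since such a vector field exists by non-degeneracy. *)
Definition left_gradient (b : geometric_structure) (F : Cinf) : vector_field :=
  xget 0 [set X | is_left_gradient b F X].

Definition right_gradient (b : geometric_structure) (F : Cinf) : vector_field :=
  xget 0 [set X | is_right_gradient b F X].

Record leibniz_bracket (br : Cinf -> Cinf -> Cinf) : Prop := LeibnizBracket {
  leibniz_linearl : forall H, linear (br ^~ H);
  leibniz_linearr : forall F, linear (br F);
  leibniz_derivl : forall F G H, br (F * G) H = F * br G H + br F H * G;
  leibniz_derivr : forall F G H, br F (G * H) = G * br F H + br F G * H }.

Definition gs_bracket (b : geometric_structure) (F G : Cinf) : Cinf :=
  b (left_gradient b F) (left_gradient b G).

End ManifoldDefs.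

Record leibniz_manifold (R : realType) (n : nat) := LeibnizManifold {
  leibniz_base :> manifold R n;
  leibniz_br : Cinf leibniz_base -> Cinf leibniz_base -> Cinf leibniz_base;
  leibniz_brP : leibniz_bracket leibniz_br }.

(* Main.v *)
Require Import Defs.
From HB Require Import structures.
From mathcomp Require Import all_boot all_order all_algebra.
From mathcomp Require Import all_classical all_reals all_analysis.
From mathcomp Require Import ring.

Set Implicit Arguments.
Unset Strict Implicit.
Unset Printing Implicit Defensive.

Import Order.TTheory GRing.Theory Num.Theory.
Import numFieldNormedType.Exports.
Local Open Scope classical_set_scope.
Local Open Scope ring_scope.

(** The content of the theorem is the existence of the two gradients; given it,
the rest is the Leibniz rule for the differential.  Writing dF for the map
X |-> dF.X, the defining equations of the gradients give
b(grad_L F, grad_L G) = dF.grad_L G = b(grad_L G, grad_R F) = dG.grad_R F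
= b(grad_R F, grad_R G), so the two formulas for the bracket agree
([gs_bracket_left_right]).  Moreover the bracket is dF.grad_L G as a function
of F and dG.grad_R F as a function of G; since F |-> dF.X is R-linear and a
derivation ([dfunC_linear], [dfunC_deriv]), the bracket is a derivation in each
entry.

The gradients are built by linear algebra over the commutative ring C^oo(M).
Let f be a bump function supported in a chart domain, and let E_k be the k-th
coordinate field times f, extended by zero to M.  Each vector field Y satisfies
the global identity f^2 Y = sum_k (f Y^k) E_k ([frame_decomposition]).  Because b
is bilinear over C^oo(M), this identity alone shows that b is determined, where f
is nonzero, by its Gram matrix B_kl = b(E_k, E_l), whose determinant is nonzero
there by non-degeneracy ([det_gram_neq0]).  Cramer's rule, applied over
C^oo(M) without any division, then produces a global vector field Z with
b(Z, Y) = D dF.Y for all Y, where D = f^2 det B ([local_gradient]).  The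
gradient is Z / D wherever D is nonzero; non-degeneracy makes these quotients
agree on overlaps, so they glue to a smooth vector field
([left_gradient_exists]).  Right gradients are left gradients of the form with
its arguments exchanged.

The analytic input is the calculus of smooth functions on open sets of R^n
(composition, inverse, locality) and the existence of bump functions, obtained
from the functions exp(-1/x) x^(-m); the Hausdorff property makes the extension
by zero of a compactly supported function smooth. *)

(** * Smooth functions on open sets of R^n *)

Section SmoothOnTheory.
Variables (R : realType) (n : nat).
Implicit Types (U V : set 'rV[R]_n) (f g : 'rV[R]_n -> R).

Lemma smooth_onS U V f : U `<=` V -> smooth_on V f -> smooth_on U f.
Proof.
move=> UV + k => /(_ k); elim: k f => [|k IH] f /=.
  by move=> cf x /UV; exact: cf.
by case=> df cf; split=> [x /UV|v]; [exact: df|exact: IH (cf v)].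
Qed.

(** Smoothness on a set is checked pointwise: [Ck_on] quantifies over the points of
the set only in front of conditions on the germ of the function at the point. *)
Lemma smooth_on_point U f :
  (forall x, U x -> smooth_on [set x] f) -> smooth_on U f.
Proof.
move=> + k => sf; have {}sf x : U x -> Ck_on k [set x] f by move=> Ux; exact: sf.
elim: k f sf => [|k IH] f sf /=; first by move=> x Ux; exact: (sf x Ux x erefl).
split=> [x Ux|v]; first by have [df _] := sf x Ux; exact: (df x erefl).
by apply: IH => x Ux; have [_ cf] := sf x Ux; exact: cf.
Qed.

(** The gluing principle: functions extended by zero and gradients are given by
different formulas on different open sets. *)
Lemma smooth_on_near U f :
  (forall x, U x -> exists V g,
    [/\ open V, V x, smooth_on V g & forall y, V y -> g y = f y]) ->
  smooth_on U f.
Proof.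
move=> H; apply: smooth_on_point => x /H[V [g [oV Vx sg gf]]].
apply: (@smooth_onS _ V) => [y ->//|k].
exact: eq_Ck_on oV gf (sg k).
Qed.

Lemma eq_smooth_on U f g : open U -> (forall x, U x -> f x = g x) ->
  smooth_on U f -> smooth_on U g.
Proof. by move=> oU fg sf k; exact: eq_Ck_on oU fg (sf k). Qed.

Lemma smooth_on_differentiable U f x :
  smooth_on U f -> U x -> differentiable f x.
Proof. by move=> /(_ 1)[+ _] => /[apply]. Qed.

Lemma smooth_on_derive U f v : smooth_on U f -> smooth_on U ('D_v f).
Proof. by move=> + k => /(_ k.+1)[_] cf; exact: cf. Qed.

Lemma Ck_on_sum k U m (F : 'I_m -> 'rV[R]_n -> R) : open U ->
  (forall i, Ck_on k U (F i)) -> Ck_on k U (fun x => \sum_i F i x).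
Proof.
move=> oU; elim: m F => [|m IH] F cF.
  rewrite (_ : (fun _ => _) = cst 0); first exact: Ck_on_cst.
  by apply/funext => x; rewrite big_ord0.
rewrite (_ : (fun _ => _) =
    (fun x => \sum_i F (widen_ord (leqnSn m) i) x) + F ord_max).
  by apply: Ck_onD => //; exact: IH.
by apply/funext => x; rewrite big_ord_recr.
Qed.

Lemma smooth_on_sum U m (F : 'I_m -> 'rV[R]_n -> R) : open U ->
  (forall i, smooth_on U (F i)) -> smooth_on U (fun x => \sum_i F i x).
Proof. by move=> oU sF k; apply: Ck_on_sum => // i; exact: sF. Qed.

Lemma Ck_onN k U f : open U -> Ck_on k U f -> Ck_on k U (- f).
Proof.
move=> oU cf; have -> : - f = cst (-1) * f.
  by apply/funext => x; rewrite !fctE mulN1r.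
by apply: Ck_onM => //; exact: Ck_on_cst.
Qed.

(** By induction on the order of differentiability, since D_v (1/f) is
- (1/f) (1/f) D_v f. *)
Lemma smooth_onV U f : open U -> (forall x, U x -> f x != 0) ->
  smooth_on U f -> smooth_on U (fun x => (f x)^-1).
Proof.
move=> oU f0 + k => /(_ k); elim: k => [|k IH] cf.
  move=> x Ux; apply: (@cvgV _ _ _ (nbhs_filter x) f (f x)); first exact: f0.
  exact: cf.
have cV := IH (Ck_onW cf); have [df Df] := cf; split=> [x Ux|v].
  by apply: differentiableV; [exact: df|exact: f0].
apply: (@eq_Ck_on _ _ _ _
  (- ((fun x => (f x)^-1) * (fun x => (f x)^-1)) * 'D_v f)) => // [x Ux|].
  rewrite deriveV ?f0//; last by apply: diff_derivable; exact: df.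
  by rewrite !fctE expr2 invfM.
apply: Ck_onM => //; last exact: Df.
by apply: Ck_onN => //; exact: Ck_onM.
Qed.

Lemma smooth_on_coord U k : smooth_on U (fun z : 'rV[R]_n => z 0 k).
Proof.
move=> [|j]; first by move=> x _; exact: coord_continuous.
split=> [x _|v]; first exact: differentiable_coord.
rewrite (_ : 'D_v _ = cst (v 0 k)); first exact: Ck_on_cst.
apply/funext => x; rewrite /derive; apply: cvg_lim => //.
apply: (@cvg_trans _ ((fun=> v 0 k) @ (0 : R)^')); last exact: cvg_cst.
apply: near_eq_cvg; near=> h.
rewrite /= !mxE addrK [RHS]mulrA mulVf ?mul1r//.
by near: h; exact: nbhs_dnbhs_neq.
Unshelve. all: by end_near. Qed.

End SmoothOnTheory.

Section RowDiff.
Variables (R : realType) (n : nat).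

Lemma differentiable_row m (T : 'rV[R]_n -> 'rV[R]_m) x :
  (forall k, differentiable (fun z => T z 0 k) x) -> differentiable T x.
Proof.
move=> dT; rewrite (_ : T = \sum_k (fun z => T z 0 k *: delta_mx 0 k)).
  by apply: differentiable_sum => k; exact: differentiableZl.
by apply/funext => z; rewrite fct_sumE [LHS]row_sum_delta.
Qed.

Lemma diff_coord m (T : 'rV[R]_n -> 'rV[R]_m) x v k :
  differentiable T x -> ('d T x v) 0 k = 'd (fun z => T z 0 k) x v.
Proof.
move=> dT; pose c (N : 'rV[R]_m) := N 0 k.
have c_lin : linear (c : _ -> R) by move=> a u w; rewrite /c !mxE.
pose cM := GRing.isLinear.Build _ _ _ _ _ c_lin.
pose cL : {linear 'rV[R]_m -> R} := HB.pack c cM.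
have cc : continuous cL by exact: coord_continuous.
rewrite (_ : (fun z => _) = cL \o T)//.
rewrite (@diff_comp _ _ _ _ T cL)//; last exact: differentiable_coord.
by rewrite /= -[c]/(cL : _ -> _) (diff_lin _ cc).
Qed.

Lemma diff_sum_coord (f : 'rV[R]_n -> R) x v : differentiable f x ->
  'd f x v = \sum_k v 0 k * 'D_(delta_mx 0 k) f x.
Proof.
move=> df; rewrite {1}(row_sum_delta v) linear_sum; apply: eq_bigr => k _.
by rewrite linearZ deriveE.
Qed.

End RowDiff.

Section SmoothComposition.
Variables (R : realType) (n : nat).

(** By induction on the order of differentiability and the chain rule
D_v (g o T) = sum_l (D_v T_l) ((D_l g) o T). *)
Lemma smooth_on_comp m (U : set 'rV[R]_n) (V : set 'rV[R]_m)
    (T : 'rV[R]_n -> 'rV[R]_m) (g : 'rV[R]_m -> R) :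
  open U -> (forall x, U x -> V (T x)) ->
  (forall k, smooth_on U (fun z => T z 0 k)) -> smooth_on V g ->
  smooth_on U (g \o T).
Proof.
move=> oU UV sT + k => /(_ k).
have dT x : U x -> differentiable T x.
  by move=> Ux; apply: differentiable_row => l;
    exact: smooth_on_differentiable (sT l) Ux.
elim: k g => [|k IH] g /= => [cg x Ux|[dg cg]].
  apply: continuous_comp; last exact/cg/UV.
  exact/differentiable_continuous/dT.
split=> [x Ux|v]; first by apply: differentiable_comp; [exact: dT|exact/dg/UV].
apply: (@eq_Ck_on _ _ _ _ (fun x => \sum_l
    ('D_v (fun z => T z 0 l) * ('D_(delta_mx 0 l) g \o T)) x)) => // [x Ux|].
  have dTx := dT x Ux; have dgx := dg _ (UV _ Ux).
  rewrite deriveE; last exact: differentiable_comp.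
  rewrite (@diff_comp _ _ _ _ T g)//= diff_sum_coord//; apply: eq_bigr => l _.
  rewrite fctE /= deriveE; last exact: smooth_on_differentiable (sT l) Ux.
  by rewrite diff_coord.
apply: Ck_on_sum => // l; apply: Ck_onM => //; last exact: IH.
exact: smooth_on_derive (sT l) k.
Qed.

End SmoothComposition.

Lemma smooth_on_open_neq0 (R : realType) (n : nat) (U : set 'rV[R]_n)
    (f : 'rV[R]_n -> R) :
  open U -> smooth_on U f -> open (U `&` [set z | f z != 0]).
Proof.
move=> oU sf; rewrite openE => z [Uz fz0]; apply: filterI.
  exact: open_nbhs_nbhs.
have cf : {for z, continuous f} by exact: (sf 0) z Uz.
apply: (cf [set y | y != 0]).
by apply: open_nbhs_nbhs; split => //; exact: open_neq.
Qed.

Lemma near_eq_diff (R : realType) (n : nat) (f g : 'rV[R]_n -> R) x v :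
  {near x, f =1 g} -> differentiable f x -> 'd g x v = 'd f x v.
Proof.
move=> fg df; have dg := near_eq_differentiable fg df.
by rewrite -!deriveE//; apply/esym; exact: near_eq_derive.
Qed.

(** * Bump functions *)

Section Bump.
Variable R : realType.

(** The family x^(-m) exp(-1/x), extended by 0 to x <= 0, is stable under
differentiation up to linear combinations, so that smoothness of the case m = 0
can be proved by an induction over all m at once. *)
Definition flat (m : nat) (x : R) : R :=
  if 0 < x then x^-1 ^+ m * expR (- x^-1) else 0.

Lemma flat_ge0 m x : 0 <= flat m x.
Proof.
rewrite /flat; case: ifPn => // x0.
by rewrite mulr_ge0 ?expR_ge0// exprn_ge0// invr_ge0 ltW.
Qed.

(** Exponential growth beats powers: exp y >= y^(m+2) / (m+2)! at y = 1/x.  The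
quadratic bound is what differentiability at 0 requires. *)
Lemma flat_le m x : flat m x <= (m.+2)`!%:R * x ^+ 2.
Proof.
rewrite /flat; case: ifPn => [x0|_]; last by rewrite mulr_ge0// sqr_ge0.
have y0 : 0 < x^-1 by rewrite invr_gt0.
rewrite expRN ler_pdivrMr ?expR_gt0//.
have /(le_trans _) H := expR_ge1Dxn m.+1 (ltW y0).
have {}H : x^-1 ^+ m.+2 / m.+2`!%:R <= expR x^-1.
  by apply: H; rewrite lerDr.
have f0 : 0 < m.+2`!%:R :> R by rewrite ltr0n fact_gt0.
set c := m.+2`!%:R in f0 H *.
apply: (@le_trans _ _ (c * x ^+ 2 * (x^-1 ^+ m.+2 / c))).
  rewrite -[in leRHS](add2n m) exprD; set y := x^-1 ^+ m.
  by rewrite [leRHS](_ : _ = y)//; field; rewrite !gt_eqF.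
by rewrite ler_wpM2l// mulr_ge0 ?sqr_ge0// ltW.
Qed.

(** Away from 0 this is the product rule; at 0 the difference quotient tends to 0
because [flat m] is bounded by a multiple of x^2. *)
Lemma is_derive_flat (m : nat) (x : R) :
  is_derive x 1 (flat m) (flat m.+2 x - m%:R * flat m.+1 x).
Proof.
have [x0|x0|->] := ltgtP x 0.
- rewrite /flat ltNge (ltW x0)/= mulr0 subr0.
  apply: (@near_eq_is_derive _ _ _ (cst 0)).
  near=> y; rewrite ifF//; apply/negbTE; rewrite -leNgt ltW//.
  by near: y; exact: lt_nbhsl.
- have flatE : {near x, (fun y : R => y^-1) ^+ m *
      (fun y : R => expR (- y^-1)) =1 flat m}.
    near=> y; have y0 : 0 < y by near: y; exact: lt_nbhsr.
    rewrite /flat y0.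
    transitivity (((fun y : R => y^-1) ^+ m) y * expR (- y^-1)) => //.
    by rewrite exprfctE.
  have xn0 : x != 0 by rewrite gt_eqF.
  have dV : is_derive x 1 (fun y : R => y^-1) (- x ^- 2).
    apply: DeriveDef; first exact: derivableV.
    by rewrite (@deriveV _ _ id)// derive_id [LHS]mulr1.
  have dE : is_derive x 1 (fun y => expR (- y^-1)) (expR (- x^-1) * x ^- 2).
    have := @is_derive1_comp R expR (fun y : R => - y^-1) x _ _
      (is_derive_expR _) (is_deriveN dV).
    by rewrite opprK mulrC.
  have dX := @is_deriveX _ _ _ m _ _ _ dV.
  apply: near_eq_is_derive flatE _; apply: (is_derive_eq (is_deriveM dX dE)).
  rewrite /flat x0 -!exprVn; case: m {dX} => [|m].
    by rewrite mul0r scale0r scaler0 addr0 mul0r subr0 expr0 scale1r mulrC.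
  have scaleE (a c : R) : a *: (c : R^o) = a * c by [].
  rewrite !scaleE -[m.+1.-1]/m exprfctE.
  rewrite (exprD x^-1 3 m) (exprD x^-1 2 m) (exprS _ m).
  set e := expR _; set z := x^-1 ^+ m; set k := m.+1%:R.
  by ring.
- rewrite /flat ltxx mulr0 subr0.
  have H : (fun h => h^-1 *: ((flat m \o shift 0) (h *: 1) - flat m 0)) @ 0^'
      --> (0 : R).
    apply/cvgr0Pnorm_le => e e0; near=> h.
    have h0 : h != 0 by near: h; exact: nbhs_dnbhs_neq.
    rewrite /= addr0 [h%:A]mulr1 {2}/flat ltxx subr0 normrM normfV.
    rewrite ler_pdivrMl ?normr_gt0// (ger0_norm (flat_ge0 _ _)).
    apply: le_trans (flat_le _ _) _.
    rewrite -real_normK ?num_real// expr2 mulrCA ler_wpM2l//.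
    rewrite mulrC -ler_pdivlMr ?ltr0n ?fact_gt0//.
    near: h; apply: dnbhs0_le.
    by rewrite divr_gt0// ltr0n fact_gt0.
  apply: DeriveDef; first by apply/cvg_ex; exists 0.
  by apply: cvg_lim => //.
Unshelve. all: by end_near. Qed.

End Bump.

Section BumpRow.
Variables (R : realType) (n : nat).
Implicit Types (U : set 'rV[R]_n) (f : 'rV[R]_n -> R).

(** Induction on k for all m simultaneously, because the derivative of [flat m]
involves [flat m.+1] and [flat m.+2]. *)
Lemma Ck_on_flat k U f m : open U -> Ck_on k U f ->
  Ck_on k U (flat m \o f).
Proof.
have dflat l (y : R) : differentiable (@flat R l) y.
  by apply/derivable1_diffP; have [] := is_derive_flat l y.
move=> oU; elim: k f m => [|k IH] f m cf.
  move=> x Ux; apply: continuous_comp; first exact: cf.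
  exact/differentiable_continuous/dflat.
have [df Df] := cf; split=> [x Ux|v].
  by apply: differentiable_comp; [exact: df|exact: dflat].
apply: (@eq_Ck_on _ _ _ _
  ((flat m.+2 \o f + - (cst m%:R * (flat m.+1 \o f))) * 'D_v f)) => //.
  move=> x Ux; have dfx := df x Ux.
  rewrite [RHS]deriveE; last exact: differentiable_comp.
  rewrite (@diff_comp _ _ _ _ f (flat m))//=.
  rewrite (@diff1E _ _ (flat m))//= derive1E -deriveE//.
  by rewrite (@derive_val _ _ _ _ _ _ _ (is_derive_flat m (f x))) [RHS]mulrC.
apply: Ck_onM => //; last exact: Df.
apply: Ck_onD => //; first exact: IH (Ck_onW cf).
apply: Ck_onN => //; apply: Ck_onM => //; first exact: Ck_on_cst.
exact: IH (Ck_onW cf).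
Qed.

(** The function z |-> flat 0 (r^2 - sum_k (z_k - a_k)^2) vanishes off the Euclidean
ball of radius r, which lies in the ball of the sup norm. *)
Lemma exists_bump (a : 'rV[R]_n) (r : R) : 0 < r ->
  exists f, [/\ smooth_on setT f, f a != 0 &
    forall z, f z != 0 -> `|z - a| <= r].
Proof.
move=> r0; pose q (z : 'rV[R]_n) := \sum_k (z 0 k - a 0 k) ^+ 2.
exists (flat 0 \o (cst (r ^+ 2) + - q)); split.
- have oT : open [set: 'rV[R]_n] by exact: openT.
  have sq : smooth_on setT q.
    apply: smooth_on_sum => // k.
    have sk : smooth_on setT ((fun z : 'rV[R]_n => z 0 k) + cst (- a 0 k)).
      by apply: smooth_onD => //; [exact: smooth_on_coord|exact: smooth_on_cst].
    apply: eq_smooth_on oT _ (smooth_onM oT sk sk) => z _.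
    by rewrite [RHS]expr2.
  move=> k; apply: Ck_on_flat => //; apply: smooth_onD => //.
    exact: smooth_on_cst.
  exact: smooth_onN.
- rewrite !fctE (_ : q a = 0); last first.
    by rewrite /q big1// => k _; rewrite subrr expr0n.
  by rewrite subr0 /flat exprn_gt0// mul1r gt_eqF// expR_gt0.
- move=> z; rewrite !fctE /flat; case: ifPn => [|_]; last by rewrite eqxx.
  rewrite subr_gt0 => qr _.
  rewrite [leLHS]/Num.norm /= mx_normrE; apply/bigmax_leP; split; first exact: ltW.
  case=> i k _ /=; rewrite ord1 !mxE.
  rewrite -(@ler_pXn2r _ 2)// ?nnegrE ?(ltW r0)// real_normK ?num_real//.
  apply: le_trans _ (ltW qr); rewrite /q (bigD1 k)//= lerDl.
  by apply: sumr_ge0 => l _; exact: sqr_ge0.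
Qed.

End BumpRow.

(** * Change of charts and extension by zero *)

Section Charts.
Variables (R : realType) (n : nat) (M : manifold R n).
Implicit Types (p q : M) (i j l : atlas M) (A K : set M).

Definition overlap i A : set 'rV[R]_n := mimg i `&` @minv _ _ M i @^-1` A.

Definition transition i j (z : 'rV[R]_n) : 'rV[R]_n := mmap j (minv i z).

Lemma mmapP i p : mdom i p -> mimg i (mmap i p).
Proof. exact: chart_mapP. Qed.

Lemma minvP i z : mimg i z -> mdom i (minv i z).
Proof. exact: chart_invP. Qed.

Lemma mmapK i p : mdom i p -> minv i (mmap i p) = p.
Proof. exact: chart_mapK. Qed.

Lemma minvK i z : mimg i z -> mmap i (minv i z) = z.
Proof. exact: chart_invK. Qed.

Lemma open_overlap i A : open A -> open (overlap i A).
Proof.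
move=> oA; rewrite openE => z [zi Az]; apply: filterI.
  by apply: open_nbhs_nbhs; split => //; exact: mimg_open.
by apply: (chart_inv_cont zi); exact: open_nbhs_nbhs.
Qed.

Lemma mdom_open i : open (mdom i).
Proof. exact: chart_dom_open. Qed.

Lemma overlap_mmap i A p : mdom i p -> A p -> overlap i A (mmap i p).
Proof. by move=> ip Ap; split; [exact: mmapP|rewrite /preimage/= mmapK]. Qed.

Lemma nbhs_overlap i A p : open A -> mdom i p -> A p ->
  nbhs (mmap i p) (overlap i A).
Proof.
move=> oA ip Ap; apply: open_nbhs_nbhs.
by split; [exact: open_overlap|exact: overlap_mmap].
Qed.

Lemma transition_smooth i j k :
  smooth_on (overlap i (mdom j)) (fun z => transition i j z 0 k).
Proof. exact: atlas_smooth. Qed.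

Lemma transition_overlap i j z :
  overlap i (mdom j) z -> overlap j (mdom i) (transition i j z).
Proof. by move=> [zi zj]; apply: overlap_mmap => //; exact: minvP. Qed.

Lemma transition_differentiable i j z :
  overlap i (mdom j) z -> differentiable (transition i j) z.
Proof.
move=> zij; apply: differentiable_row => k.
exact: smooth_on_differentiable (@transition_smooth i j k) zij.
Qed.

(** The chain rule for F o minv i = (F o minv j) o (transition i j), an identity
that holds near the point. *)
Lemma diff_chart_change (F : M -> R) i j p v : mdom i p -> mdom j p ->
  differentiable (F \o minv j) (mmap j p) ->
  'd (F \o minv i) (mmap i p) v =
  'd (F \o minv j) (mmap j p) ('d (transition i j) (mmap i p) v).
Proof.
move=> ip jp dF; have pij := overlap_mmap ip jp.
have dT := transition_differentiable pij.
have Tp : transition i j (mmap i p) = mmap j p by rewrite /transition mmapK.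
have dF' : differentiable (F \o minv j) (transition i j (mmap i p)).
  by rewrite Tp.
transitivity ('d ((F \o minv j) \o transition i j) (mmap i p) v).
  apply: near_eq_diff; last exact: differentiable_comp.
  apply: filterS (nbhs_overlap (@mdom_open j) ip jp) => z [zi zj].
  by rewrite /= /transition mmapK.
pose w := 'd (transition i j) (mmap i p) v.
transitivity ('d (F \o minv j) (transition i j (mmap i p)) w).
  by have := congr1 (@^~ v) (diff_comp dT dF').
exact: (congr1 (fun x => 'd (F \o minv j) x w) Tp).
Qed.

Lemma transition_cocycle i j l p v : mdom i p -> mdom j p -> mdom l p ->
  'd (transition i l) (mmap i p) v =
  'd (transition j l) (mmap j p) ('d (transition i j) (mmap i p) v).
Proof.
move=> ip jp lp; apply/rowP => k.
rewrite !diff_coord; do ?[exact/transition_differentiable/overlap_mmap].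
apply: (@diff_chart_change (fun q => mmap l q 0 k)) => //.
apply: smooth_on_differentiable (@transition_smooth j l k) _.
exact: overlap_mmap.
Qed.

Lemma transition_refl i p v : mdom i p ->
  'd (transition i i) (mmap i p) v = v.
Proof.
move=> ip; apply/rowP => k; have pii := overlap_mmap ip ip.
rewrite diff_coord; last exact: transition_differentiable.
transitivity ('d (fun z : 'rV[R]_n => z 0 k) (mmap i p) v).
  apply: near_eq_diff; last exact: differentiable_coord.
  apply: filterS (nbhs_overlap (@mdom_open i) ip ip) => z [zi _].
  by rewrite /transition minvK.
by rewrite -(@diff_coord _ _ _ id)// diff_val.
Qed.

Lemma tangent_chart_change p (v : atlas M -> 'rV[R]_n) i j :
  is_tangent p v -> mdom i p -> mdom j p ->
  v j = 'd (transition i j) (mmap i p) (v i).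
Proof.
move=> [_ tv] ip jp; apply/rowP => k; rewrite (tv i j)// diff_coord//.
exact/transition_differentiable/overlap_mmap.
Qed.

(** Near a point outside the closed set K the function is constantly 0, and near a
point of K it lives on the overlap of the two charts. *)
Lemma smooth_on_ext0 i j K (g : 'rV[R]_n -> R) : closed K -> K `<=` mdom i ->
  (forall z, mimg j z -> ~ K (minv j z) -> g z = 0) ->
  smooth_on (overlap j (mdom i)) g -> smooth_on (mimg j) g.
Proof.
move=> cK Ki g0 sg; apply: smooth_on_near => z zj.
have [Kz|nKz] := pselect (K (minv j z)).
  exists (overlap j (mdom i)), g; split=> //; last by split => //; exact: Ki.
  exact/open_overlap/mdom_open.
exists (overlap j (~` K)), (cst 0); split=> //.
- by apply: open_overlap; exact: closed_openC.
- exact: smooth_on_cst.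
- by move=> y [yj Ky]; rewrite g0.
Qed.

(** The closed set K separates the points where f is nonzero from the complement of
the chart domain, which is what extending by zero needs. *)
Definition supported_in i (f : M -> R) :=
  exists K, [/\ closed K, K `<=` mdom i & forall q, f q != 0 -> K q].

Lemma supported_out i (f : M -> R) q : supported_in i f -> ~ mdom i q -> f q = 0.
Proof.
by move=> [K [_ Ki fK]] iq; apply/eqP; apply: contra_notT iq => /fK/Ki.
Qed.

Lemma smooth_on_supported i j (f : M -> R) (g : 'rV[R]_n -> R) :
  supported_in i f ->
  (forall z, mimg j z -> f (minv j z) = 0 -> g z = 0) ->
  smooth_on (overlap j (mdom i)) g -> smooth_on (mimg j) g.
Proof.
move=> [K [cK Ki fK]] g0; apply: (smooth_on_ext0 cK Ki) => z zj nKz.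
by apply: g0 => //; apply/eqP; apply: contra_notT nKz; exact: fK.
Qed.

(** A bump function in coordinates is supported in a closed ball inside the image of
the chart.  The corresponding subset of M is compact, hence closed because M is
Hausdorff, and extension by zero applies. *)
Lemma exists_chart_bump i p : mdom i p ->
  exists f : Cinf M, f p != 0 /\ supported_in i f.
Proof.
move=> ip; have : nbhs (mmap i p) (mimg i).
  by apply: open_nbhs_nbhs; split; [exact: mimg_open|exact: mmapP].
move=> /nbhs_closedballP[r rU].
have [h [sh h0 hr]] := exists_bump (mmap i p) (gt0 r).
pose K := @minv _ _ M i @` closed_ball (mmap i p) r%:num.
have KU : K `<=` mdom i by move=> _ [z /rU zi <-]; exact: minvP.
have cK : closed K.
  apply: compact_closed; first exact: manifold_hausdorff.
  apply: continuous_compact.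
    apply: continuous_in_subspaceT => z /set_mem /rU.
    exact: chart_inv_cont.
  apply: bounded_closed_compact; last exact: closed_ball_closed.
  exists (`|mmap i p| + r%:num); split; first exact: num_real.
  move=> y y_gt z; rewrite closed_ballE// => az; apply: (le_trans _ (ltW y_gt)).
  rewrite -[z in leLHS](subKr (mmap i p)) (le_trans (ler_normB _ _))//.
  by rewrite lerD2l.
pose f q := if `[< mdom i q >] then h (mmap i q) else 0.
have fK q : f q != 0 -> K q.
  rewrite /f; case: asboolP => [iq hq|]; last by rewrite eqxx.
  exists (mmap i q); last exact: mmapK.
  by rewrite closed_ballE// /closed_ball_ /= distrC; exact: hr.
have sf : smooth_fun f.
  move=> j; apply: (smooth_on_ext0 cK KU) => [z zj|].
    by move=> nK; apply/eqP; apply: contra_notT nK; exact: fK.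
  have oij : open (overlap j (mdom i)) by exact/open_overlap/mdom_open.
  apply: (eq_smooth_on (f := h \o transition j i)) => //.
    by move=> z [zj zi]; rewrite /f /= asboolT.
  exact: (smooth_on_comp (V := setT)) (@transition_smooth j i) sh.
exists (MkCinf (mem_set sf)); split; first by rewrite /= /f asboolT.
by exists K.
Qed.

End Charts.

(** * The differential as a form over the ring of smooth functions *)

Section Algebra.
Variables (R : realType) (n : nat) (M : manifold R n).
Implicit Types (p q : M) (i j l : atlas M) (F : Cinf M) (X Y : vector_field M).

Definition ev p (F : Cinf M) : R := F p.

Lemma ev_is_zmod_morphism p : zmod_morphism (ev p).
Proof. by []. Qed.

Lemma ev_is_monoid_morphism p : monoid_morphism (ev p).
Proof. by []. Qed.

HB.instance Definition _ p :=
  GRing.isZmodMorphism.Build (Cinf M) R (ev p) (ev_is_zmod_morphism p).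
HB.instance Definition _ p :=
  GRing.isMonoidMorphism.Build (Cinf M) R (ev p) (ev_is_monoid_morphism p).

Definition comp_at p j (X : vector_field M) : 'rV[R]_n := X p j.

Lemma comp_at_is_zmod_morphism p j : zmod_morphism (comp_at p j).
Proof. by []. Qed.

HB.instance Definition _ p j :=
  GRing.isZmodMorphism.Build (vector_field M) 'rV[R]_n (comp_at p j)
    (comp_at_is_zmod_morphism p j).

Lemma Cinf_sumE m (f : 'I_m -> Cinf M) p : (\sum_k f k) p = \sum_k f k p.
Proof. exact: (raddf_sum (ev p)). Qed.

Lemma vector_field_sumE m (X : 'I_m -> vector_field M) p j :
  (\sum_k X k) p j = \sum_k X k p j.
Proof. exact: (raddf_sum (comp_at p j)). Qed.

Lemma scalar_sum (A : pzRingType) (V : lmodType A) (f : V -> A) m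
    (c : 'I_m -> A) (X : 'I_m -> V) :
  scalar f -> f (\sum_k c k *: X k) = \sum_k c k * f (X k).
Proof.
move=> f_lin; pose fM := GRing.isLinear.Build _ _ _ _ _ f_lin.
pose fL : {scalar V} := HB.pack f fM.
rewrite -[f]/(fL : _ -> _) linear_sum; apply: eq_bigr => k _.
by rewrite linearZ.
Qed.

Lemma scalarZl (A : pzRingType) (V : lmodType A) (f : V -> A) (a : A) (x : V) :
  scalar f -> f (a *: x) = a * f x.
Proof.
move=> f_lin; pose fM := GRing.isLinear.Build _ _ _ _ _ f_lin.
pose fL : {scalar V} := HB.pack f fM.
by rewrite -[f]/(fL : _ -> _) linearZ.
Qed.

(** The value of dF on a tangent vector can be computed in any chart: the
transformation law of the vector compensates the chain rule for F. *)
Lemma dfunE F X j p : mdom j p ->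
  dfun F X p = 'd (F \o minv j) (mmap j p) (X p j).
Proof.
move=> jp; have cp := chart_atP p; have [tX _] := vector_fieldP X.
have dF : differentiable (F \o minv j) (mmap j p).
  exact: smooth_on_differentiable (Cinf_smooth F j) (mmapP jp).
rewrite (tangent_chart_change (tX p) cp jp).
exact: diff_chart_change cp jp dF.
Qed.

Lemma dfun_smooth F X : smooth_fun (dfun F X).
Proof.
move=> j; have [_ sX] := vector_fieldP X.
have oj : open (mimg j) by exact: mimg_open.
apply: (eq_smooth_on (f := fun z => \sum_k ((fun z => X (minv j z) j 0 k) *
    'D_(delta_mx 0 k) (F \o minv j)) z)) => //.
  move=> z zj; have dF := smooth_on_differentiable (Cinf_smooth F j) zj.
  rewrite /= (dfunE F X (minvP zj)) (minvK zj) diff_sum_coord//.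
apply: smooth_on_sum => // k; apply: smooth_onM => //.
exact/smooth_on_derive/Cinf_smooth.
Qed.

Definition dfunC F X : Cinf M := MkCinf (mem_set (@dfun_smooth F X)).

Lemma dfunC_scalar F : scalar (dfunC F).
Proof.
move=> a X Y; apply/CinfP => p.
set i := chart_at p; pose d := 'd (F \o minv i) (mmap i p).
exact: (linearP d (a p) (X p i) (Y p i)).
Qed.

End Algebra.

(** * Localized coordinate frames *)

Section Frames.
Variables (R : realType) (n : nat) (M : manifold R n).
Variables (i : atlas M) (f : Cinf M).
Hypothesis f_supp : supported_in i f.
Implicit Types (p q : M) (j l : atlas M) (X Y : vector_field M).

(** In the chart j, the k-th coordinate field of the chart i multiplied by f. *)
Definition frame_fun (k : 'I_n) (p : M) (j : atlas M) : 'rV[R]_n :=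
  if `[< mdom i p /\ mdom j p >]
  then f p *: 'd (transition i j) (mmap i p) (delta_mx 0 k) else 0.

Lemma frame_funE k p j : mdom i p -> mdom j p ->
  frame_fun k p j = f p *: 'd (transition i j) (mmap i p) (delta_mx 0 k).
Proof. by move=> ip jp; rewrite /frame_fun asboolT. Qed.

Lemma frame_fun0 k p j : ~ (mdom i p /\ mdom j p) -> frame_fun k p j = 0.
Proof. by move=> ijp; rewrite /frame_fun asboolF. Qed.

Lemma frame_fun_tangent k p : is_tangent p (frame_fun k p).
Proof.
split=> [j jp|j l jp lp m]; first by apply: frame_fun0 => -[].
have dT := transition_differentiable (overlap_mmap jp lp).
apply: etrans (diff_coord _ m dT).
have [ip|ip] := pselect (mdom i p); last first.
  by rewrite !frame_fun0 ?linear0//; case.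
rewrite !frame_funE//.
pose e : 'rV[R]_n := delta_mx 0 k.
have E := transition_cocycle e ip jp lp.
apply: etrans (congr1 (fun v : 'rV[R]_n => (f p *: v) 0 m) E) _.
apply: (congr1 (fun v : 'rV[R]_n => v 0 m)); apply: esym.
exact: (linearZ_LR ('d (transition j l) (mmap j p))).
Qed.

Lemma frame_fun_smooth k j m :
  smooth_on (mimg j) (fun z => frame_fun k (minv j z) j 0 m).
Proof.
(* On the overlap, the component is f times a partial derivative of the
   transition map, read in the chart j through the inverse transition. *)
apply: (smooth_on_supported f_supp) => [z zj f0|].
  rewrite /frame_fun; case: asboolP => _; last by rewrite mxE.
  by rewrite f0 scale0r mxE.
have oji : open (overlap j (@mdom _ _ M i)) by exact/open_overlap/mdom_open.
pose D := 'D_(delta_mx 0 k) (fun z => @transition _ _ M i j z 0 m).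
apply: (@eq_smooth_on _ _ _ ((f \o minv j) * (D \o transition j i))) => //.
  move=> z zji; have [zj zi] := zji; have jp := minvP zj.
  rewrite frame_funE// mxE; congr (_ * _).
  have pij := overlap_mmap zi jp.
  have dT := transition_differentiable pij.
  apply: etrans (esym (diff_coord _ m dT)).
  rewrite /D /= deriveE//.
  exact: smooth_on_differentiable (@transition_smooth _ _ M i j m) pij.
apply: smooth_onM => //.
  by apply: smooth_onS (Cinf_smooth f j) => z [].
apply: smooth_on_comp oji _ (@transition_smooth _ _ M j i) _.
  exact: transition_overlap.
exact/smooth_on_derive/transition_smooth.
Qed.

Definition frame k : vector_field M :=
  VectorField (mem_set (conj (frame_fun_tangent k) (frame_fun_smooth k))).

Lemma frame_coord k p : mdom i p -> frame k p i = f p *: delta_mx 0 k.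
Proof. by move=> ip; rewrite [LHS]frame_funE// transition_refl. Qed.

Lemma coord_fun_smooth X k : smooth_fun (fun p => f p * X p i 0 k).
Proof.
have [tX sX] := vector_fieldP X; move=> j.
apply: (smooth_on_supported f_supp) => [z zj /= ->|]; first by rewrite mul0r.
have oji : open (overlap j (@mdom _ _ M i)) by exact/open_overlap/mdom_open.
apply: (@eq_smooth_on _ _ _ ((f \o minv j) * (fun z => \sum_m
    ((fun z => X (minv j z) j 0 m) *
     'D_(delta_mx 0 m) (fun z => @transition _ _ M j i z 0 k)) z))) => //.
  move=> z zji; have [zj zi] := zji; have jp := minvP zj.
  rewrite /=; congr (_ * _).
  have := tangent_chart_change (tX (minv j z)) jp zi.
  move=> /(congr1 (fun v : 'rV[R]_n => v 0 k)) ->; rewrite (minvK zj).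
  have dT := transition_differentiable zji.
  apply: etrans (esym (diff_coord _ k dT)).
  apply: esym; apply: diff_sum_coord.
  exact: smooth_on_differentiable (@transition_smooth _ _ M j i k) zji.
apply: smooth_onM => //.
  by apply: smooth_onS (Cinf_smooth f j) => z [].
apply: smooth_on_sum => // m; apply: smooth_onM => //.
  by apply: smooth_onS (sX j m) => z [].
exact/smooth_on_derive/transition_smooth.
Qed.

Definition coord_fun X k : Cinf M := MkCinf (mem_set (@coord_fun_smooth X k)).

(** Both factors f on the left are needed for the terms on the right to be global
objects: one makes the coordinates of X global functions, the other makes the
coordinate fields global vector fields. *)
Lemma frame_decomposition X :
  (f * f) *: X = \sum_k coord_fun X k *: frame k.
Proof.
have [tX _] := vector_fieldP X; apply/eq_vector_field => p j.
rewrite vector_field_sumE.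
transitivity (\sum_k (f p * X p i 0 k) *: frame_fun k p j) => //.
transitivity ((f p * f p) *: X p j) => //.
have [ip|ip] := pselect (mdom i p); last first.
  rewrite (supported_out f_supp ip) mul0r scale0r big1// => k _.
  by rewrite mul0r scale0r.
have [jp|jp] := pselect (mdom j p); last first.
  rewrite (tX p).1// scaler0 big1// => k _.
  by rewrite frame_fun0 ?scaler0//; case.
rewrite (tangent_chart_change (tX p) ip jp).
rewrite {1}(row_sum_delta (X p i)) (linear_sum ('d (transition i j) (mmap i p))).
rewrite scaler_sumr; apply: eq_bigr => k _.
rewrite frame_funE// (linearZ_LR ('d (transition i j) (mmap i p))).
by rewrite !scalerA mulrAC.
Qed.

End Frames.

(** * Existence of gradients *)

Section Gradient.
Variables (R : realType) (n : nat) (M : manifold R n).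
Variable b : geometric_structure M.
Implicit Types (p : M) (F G H : Cinf M) (X Y Z : vector_field M).

(** By bilinearity f^2 b(X, Y) = sum_k (f Y^k) b(X, E_k), so b(X, Y) vanishes at p
for every Y, and non-degeneracy applies. *)
Lemma gs_zero_at_frame i (f : Cinf M) (fi : supported_in i f) X p :
  f p != 0 -> (forall k, b X (frame fi k) p = 0) -> X p = 0.
Proof.
move=> fp0 bX0; apply: (@gs_nondegl _ _ _ b) => Y.
have := congr1 (ev p) (scalarZl (f * f) Y (gs_linearr b X)).
rewrite (frame_decomposition fi) (scalar_sum _ _ (gs_linearr b X)).
rewrite rmorphM rmorph_sum big1 => [|k _]; last first.
  by rewrite -[LHS]/(coord_fun fi Y k p * b X (frame fi k) p) bX0 mulr0.
move=> /esym/eqP; rewrite mulf_eq0 => /orP[|/eqP//].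
by rewrite rmorphM mulf_eq0 orbb => /eqP f0; move/eqP: fp0.
Qed.

Definition gram i (f : Cinf M) (fi : supported_in i f) : 'M[Cinf M]_n :=
  \matrix_(k, l) b (frame fi k) (frame fi l).

(** A vector v in the left kernel of the Gram matrix at p yields the field
X = sum_k v_k E_k, which is b-orthogonal to the frame at p and hence vanishes at
p; its coordinates there are f(p) v_k. *)
Lemma det_gram_neq0 i (f : Cinf M) (fi : supported_in i f) p :
  f p != 0 -> (\det (gram fi)) p != 0.
Proof.
move=> fp0; rewrite -[X in X != 0]/(ev p _) -det_map_mx.
apply/negP => /det0P[v v0 vB].
pose X := \sum_k (v 0 k *: (1 : Cinf M)) *: frame fi k.
have X0 : X p = 0.
  apply: (gs_zero_at_frame (fi := fi)) fp0 _ => l.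
  rewrite /X (scalar_sum _ _ (gs_linearl b _)).
  have := congr1 (fun w : 'rV[R]_n => w 0 l) vB; rewrite !mxE => vBl.
  rewrite Cinf_sumE -[RHS]vBl; apply: eq_bigr => k _; rewrite !mxE.
  by rewrite -[LHS]/(v 0 k * 1 * _) mulr1.
have ip : mdom i p.
  apply: contrapT => ip; move/eqP: fp0; apply.
  exact: supported_out fi ip.
move/eqP: v0; apply; apply/rowP => k; rewrite mxE.
have : X p i 0 k = f p * v 0 k.
  rewrite vector_field_sumE summxE (bigD1 k)//= big1 => [|l lk].
    rewrite addr0 -[LHS]/((v 0 k * 1 *: frame fi k p i) 0 k).
    by rewrite frame_coord// !mxE !eqxx !mulr1 mulrC.
  rewrite -[LHS]/((v 0 l * 1 *: frame fi l p i) 0 k).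
  by rewrite frame_coord// !mxE eqxx/= eq_sym (negbTE lk) !mulr0.
rewrite X0 mxE => /esym/eqP; rewrite mulf_eq0 => /orP[/eqP f0|/eqP//].
by move/eqP: fp0.
Qed.

(** With d_l = dF.E_l and c = d adj(B), the field Z = sum_k c_k E_k satisfies
b(Z, E_l) = det B d_l by Cramer's rule.  Since f^2 Y is
a combination of the frame fields and both sides are linear in Y over the smooth
functions, f^2 b(Z, Y) = f^2 det B dF.Y for every Y. *)
Lemma local_gradient F p : exists (D : Cinf M) Z,
  D p != 0 /\ forall Y, b Z Y = D * dfunC F Y.
Proof.
have [f [fp0 fi]] := exists_chart_bump (chart_atP p).
pose d : 'rV[Cinf M]_n := \row_k dfunC F (frame fi k).
pose B := gram fi; pose c := d *m \adj B.
pose Z := \sum_k c 0 k *: frame fi k.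
have bZ l : b Z (frame fi l) = \det B * dfunC F (frame fi l).
  have := congr1 (mulmx d) (mul_adj_mx B).
  rewrite mulmxA mul_mx_scalar => /(congr1 (fun w : 'rV_n => w 0 l)).
  rewrite !mxE => <-; rewrite (scalar_sum _ _ (gs_linearl b _)).
  by apply: eq_bigr => k _; congr (_ * _); rewrite /B mxE.
exists (f * f * \det B), ((f * f) *: Z); split.
  have detB := det_gram_neq0 fi fp0.
  by rewrite -[X in X != 0]/(f p * f p * (\det B) p) !mulf_neq0.
move=> Y; rewrite (scalarZl _ _ (gs_linearl b Y)).
rewrite -(scalarZl _ _ (gs_linearr b Z)).
rewrite mulrAC -(scalarZl _ _ (dfunC_scalar F)) (frame_decomposition fi).
rewrite (scalar_sum _ _ (gs_linearr b Z)) (scalar_sum _ _ (dfunC_scalar F)).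
by rewrite mulr_suml; apply: eq_bigr => k _; rewrite bZ mulrCA mulrC.
Qed.

(** With b(Z_q, Y) = D_q dF.Y for all Y and D_q nonzero at q, the gradient at p is
Z_p(p) / D_p(p).  At any p with D_q(p) nonzero it equals Z_q(p) / D_q(p), and for
fixed q this expression is smooth where D_q is nonzero, a neighbourhood of q. *)
Lemma left_gradient_exists F : exists X, is_left_gradient b F X.
Proof.
have /choice[DZ DZP] : forall p, exists DZ : Cinf M * vector_field M,
    DZ.1 p != 0 /\ forall Y, b DZ.2 Y = DZ.1 * dfunC F Y.
  by move=> p; have [D [Z DZ]] := local_gradient F p; exists (D, Z).
pose D p := (DZ p).1; pose Z p := (DZ p).2.
have Dp0 p : D p p != 0 by have [] := DZP p.
have bZ p Y : b (Z p) Y = D p * dfunC F Y by have [_] := DZP p; exact.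
pose X p i : 'rV[R]_n := (D p p)^-1 *: Z p p i.
have XE q p i : D q p != 0 -> X p i = (D q p)^-1 *: Z q p i.
  move=> Dqp; pose W := D q *: Z p + (- D p) *: Z q.
  (* b(W, Y) = D_q D_p dF.Y - D_p D_q dF.Y, so W vanishes at p. *)
  have : W p = 0.
    apply: (@gs_nondegl _ _ _ b) => Y.
    rewrite (gs_linearl b Y) (scalarZl _ _ (gs_linearl b Y)) !bZ.
    by rewrite mulNr mulrCA subrr.
  move=> /(congr1 (fun w => w i)) Wpi.
  have {}Wpi : D q p *: Z p p i - D p p *: Z q p i = 0.
    by rewrite -scaleNr -[RHS]Wpi.
  have {}Wpi := subr0_eq Wpi.
  rewrite /X -[Z p p i](scalerK Dqp) Wpi scalerA scalerA.
  by rewrite mulrAC mulVf ?mul1r.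
have tX p : is_tangent p (X p).
  have [tZ _] := vector_fieldP (Z p); have [Z0 Zc] := tZ p.
  split=> [i ip|i j ip jp k]; first by rewrite /X Z0// scaler0.
  rewrite /X mxE (Zc i j)//; apply: esym.
  exact: (linearZ_LR ('d (fun z => mmap j (minv i z) 0 k) (mmap i p))).
have sX i k : smooth_on (mimg i) (fun z => X (minv i z) i 0 k).
  have oi : open (mimg i) by exact: mimg_open.
  apply: smooth_on_near => z zi; pose q := minv i z.
  pose V := mimg i `&` [set z | (D q \o minv i) z != 0].
  have [_ sZ] := vector_fieldP (Z q).
  have oV : open V by exact: smooth_on_open_neq0 oi (Cinf_smooth (D q) i).
  have VU : V `<=` mimg i by move=> y [].
  exists V, ((fun z => ((D q \o minv i) z)^-1) *
             (fun z => Z q (minv i z) i 0 k)); split=> //.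
  - by split => //=; exact: Dp0.
  - apply: smooth_onM => //; last exact: smooth_onS VU (sZ i k).
    apply: smooth_onV => // [y [_]//|].
    exact: smooth_onS VU (Cinf_smooth (D q) i).
  - by move=> y [yi Dy]; rewrite (XE q)// mxE.
pose XF : vector_field M := VectorField (mem_set (conj tX sX)).
(* Multiplying by a second factor D_q makes the identity hold also where D_q
   vanishes, so that bilinearity of b over the smooth functions applies to it. *)
have DX q : (D q * D q) *: XF = D q *: Z q.
  apply/eq_vector_field => p i.
  rewrite -[LHS]/((D q p * D q p) *: X p i) -[RHS]/(D q p *: Z q p i).
  have [->|Dqp] := eqVneq (D q p) 0; first by rewrite mul0r !scale0r.
  by rewrite (XE q)// scalerA mulfK.
exists XF => Y; apply/funext => p.
have E : D p * D p * b XF Y = D p * D p * dfunC F Y.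
  rewrite -(scalarZl _ _ (gs_linearl b Y)) DX.
  by rewrite (scalarZl _ _ (gs_linearl b Y)) bZ mulrA.
have {}E : D p p * D p p * b XF Y p = D p p * D p p * dfun F Y p.
  exact: (congr1 (ev p) E).
by apply: mulfI E; rewrite mulf_neq0.
Qed.

End Gradient.

(** * The Leibniz bracket *)

Section BothGradients.
Variables (R : realType) (n : nat) (M : manifold R n).
Variable b : geometric_structure M.

Definition gs_opp : geometric_structure M :=
  GeometricStructure (gs_form := fun X Y => b Y X)
    (gs_linearr b) (gs_linearl b) (@gs_nondegr _ _ _ b) (@gs_nondegl _ _ _ b).

Lemma left_gradientP F : is_left_gradient b F (left_gradient b F).
Proof.
rewrite /left_gradient; case: xgetP => // noX.
by have [X /noX] := left_gradient_exists b F.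
Qed.

Lemma right_gradientP F : is_right_gradient b F (right_gradient b F).
Proof.
rewrite /right_gradient; case: xgetP => // noX.
by have [X /noX] := left_gradient_exists gs_opp F.
Qed.

Lemma dfun_left_gradient F Y : b (left_gradient b F) Y = dfunC F Y.
Proof. exact/val_inj/left_gradientP. Qed.

Lemma dfun_right_gradient F Y : b Y (right_gradient b F) = dfunC F Y.
Proof. exact/val_inj/right_gradientP. Qed.

(** Both sides are equal to b(grad_L G, grad_R F). *)
Lemma gs_bracket_left_right F G :
  b (left_gradient b F) (left_gradient b G) =
  b (right_gradient b F) (right_gradient b G).
Proof.
rewrite dfun_left_gradient -(dfun_right_gradient F) dfun_left_gradient.
by rewrite -dfun_right_gradient.
Qed.

End BothGradients.

Section Leibniz.
Variables (R : realType) (n : nat) (M : manifold R n).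
Implicit Types (F G : Cinf M) (X : vector_field M).

Lemma dfunC_linear X : linear (fun F => dfunC F X).
Proof.
move=> a F G; apply/CinfP => p.
have jp := chart_atP p; set j := chart_at p in jp.
have dF := smooth_on_differentiable (Cinf_smooth F j) (mmapP jp).
have dG := smooth_on_differentiable (Cinf_smooth G j) (mmapP jp).
rewrite -[LHS]/('d (a *: (F \o minv j) + (G \o minv j)) (mmap j p) (X p j)).
rewrite -[RHS]/(a * 'd (F \o minv j) (mmap j p) (X p j) +
               'd (G \o minv j) (mmap j p) (X p j)).
have daF := differentiableZ a dF.
by rewrite (diffD daF dG) (diffZ a dF).
Qed.

Lemma dfunC_deriv F G X : dfunC (F * G) X = F * dfunC G X + dfunC F X * G.
Proof.
apply/CinfP => p; have jp := chart_atP p; set j := chart_at p in jp.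
have dF := smooth_on_differentiable (Cinf_smooth F j) (mmapP jp).
have dG := smooth_on_differentiable (Cinf_smooth G j) (mmapP jp).
rewrite -[LHS]/('d ((F \o minv j) * (G \o minv j)) (mmap j p) (X p j)).
rewrite -[RHS]/(F p * 'd (G \o minv j) (mmap j p) (X p j) +
               'd (F \o minv j) (mmap j p) (X p j) * G p).
rewrite (diffM dF dG) /= (mmapK jp).
by rewrite [X in _ = _ + X]mulrC.
Qed.

Variable b : geometric_structure M.

Lemma gs_bracket_leftE F G : gs_bracket b F G = dfunC F (left_gradient b G).
Proof. exact: dfun_left_gradient. Qed.

Lemma gs_bracket_rightE F G : gs_bracket b F G = dfunC G (right_gradient b F).
Proof. by rewrite /gs_bracket gs_bracket_left_right dfun_right_gradient. Qed.

Lemma gs_bracket_leibniz : leibniz_bracket (gs_bracket b).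
Proof.
split=> [H a F G|F a G H|F G H|F G H].
- by rewrite !gs_bracket_leftE dfunC_linear.
- by rewrite !gs_bracket_rightE dfunC_linear.
- by rewrite !gs_bracket_leftE dfunC_deriv.
- by rewrite !gs_bracket_rightE dfunC_deriv.
Qed.

End Leibniz.

Theorem theorem3p7 (R : realType) (n : nat) (M : manifold R n)
    (b : geometric_structure M) :
  [/\ forall F G : Cinf M,
        b (left_gradient b F) (left_gradient b G) =
        b (right_gradient b F) (right_gradient b G),
      leibniz_bracket (gs_bracket b) &
      exists N : leibniz_manifold R n,
        existT (fun M' : manifold R n => Cinf M' -> Cinf M' -> Cinf M')
          (leibniz_base N) (@leibniz_br R n N) =
        existT (fun M' : manifold R n => Cinf M' -> Cinf M' -> Cinf M')
          M (gs_bracket b)].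
Proof.
split; first exact: gs_bracket_left_right.
  exact: gs_bracket_leibniz.
by exists (LeibnizManifold (gs_bracket_leibniz b)).
Qed.
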